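(* Let $M$ and $N$ be finite groups and let $G = M\times N$, so that $\mathrm{Irr}(G)=\mathrm{Irr}(M)\times\mathrm{Irr}(N)$. Let $(\mathcal X,\mathcal K)$ be a supercharacter theory of $M$ and $(\mathcal Y,\mathcal L)$ a supercharacter theory of $N$. Put $$\mathcal Z=\{X\times Y : X\in\mathcal X,\ Y\in\mathcal Y\},\qquad X\times Y=\{\phi\times\theta : \phi\in X,\ \theta\in Y\}\subseteq \mathrm{Irr}(G),$$ $$\mathcal M=\{K\times L : K\in\mathcal K,\ L\in\mathcal L\},\qquad K\times L=\{(m,n) : m\in K,\ n\in L\}\subseteq G .$$ Then $(\mathcal Z,\mathcal M)$ is a supercharacter theory of $G$.
   Context: All groups are finite and $\mathrm{Irr}(G)$ is the set of complex irreducible characters of $G$. For $\phi\in\mathrm{Irr}(M)$, $\theta\in\mathrm{Irr}(N)$, $\phi\times\theta$ is the character $(m,n)\mapsto\phi(m)\theta(n)$. A supercharacter theory of $G$ is a pair $(\mathcal X,\mathcal K)$, with $\mathcal X$ a partition of $\mathrm{Irr}(G)$ and $\mathcal K$ a partition of $G$, such that $|\mathcal X|=|\mathcal K|$ and for every $X\in\mathcal X$ there is a character $\chi_X$ of $G$ whose irreducible constituents lie in $X$, with each $\chi_X$ constant on every part $K\in\mathcal K$, and every irreducible character of $G$ a constituent of some $\chi_X$. (It is known, by Diaconis and Isaacs, that $\chi_X$ is then a constant multiple of $\sigma_X=\sum_{\psi\in X}\psi(1)\psi$, and one always takes $\chi_X=\sigma_X$.) *)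

(* Defs.v *)
From HB Require Import structures.
From mathcomp Require Import all_boot all_order all_fingroup all_algebra.
From mathcomp Require Import all_solvable all_field all_character.

Set Implicit Arguments.
Unset Strict Implicit.
Unset Printing Implicit Defensive.

Import Order.TTheory GroupScope GRing.Theory Num.Theory.
Local Open Scope ring_scope.

(* Irr(G) is represented, as usual, by the index type Iirr G of its elements
   'chi[G]_i. The value of chi outside XX is irrelevant. *)
Definition supercharacter_theory (gT : finGroupType) (G : {group gT})
    (XX : {set {set Iirr G}}) (KK : {set {set gT}}) : Prop :=
  [/\ partition XX [set: Iirr G],
      partition KK G,
      #|XX| = #|KK|
    & exists chi : {set Iirr G} -> 'CF(G),
        [/\ {in XX, forall X : {set Iirr G}, chi X \is a character},
            {in XX, forall X : {set Iirr G}, {subset irr_constt (chi X) <= X}},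
            {in XX & KK, forall (X : {set Iirr G}) (K : {set gT}),
               {in K &, forall x y, chi X x = chi X y}}
          & forall i : Iirr G, exists2 X, X \in XX & i \in irr_constt (chi X)]].
Arguments supercharacter_theory {gT} G XX KK.

Section ExternalProduct.

Variables (gT1 gT2 : finGroupType) (M : {group gT1}) (N : {group gT2}).

Fact cfprod_subproof (phi : 'CF(M)) (theta : 'CF(N)) :
  is_class_fun <<setX M N>> [ffun x => phi x.1 * theta x.2].
Proof.
rewrite genGid; apply: intro_class_fun => [[x1 x2] [y1 y2] | [x1 x2]].
  by rewrite !inE /= => _ /andP[My Ny]; rewrite !cfunJ.
rewrite inE /= negb_and => /orP[] notx; first by rewrite cfun0 ?mul0r.
by rewrite (cfun0 theta) ?mulr0.
Qed.
Definition cfprod (phi : 'CF(M)) (theta : 'CF(N)) : 'CF(setX M N) :=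
  Cfun 0 (cfprod_subproof phi theta).

Lemma cfprodE phi theta m n : cfprod phi theta (m, n) = phi m * theta n.
Proof. by rewrite cfunE. Qed.

Lemma cfdot_prod phi1 phi2 theta1 theta2 :
  '[cfprod phi1 theta1, cfprod phi2 theta2] = '[phi1, phi2] * '[theta1, theta2].
Proof.
rewrite !cfdotE cardsX natrM invfM mulrACA; congr (_ * _).
rewrite big_distrlr pair_big /=.
by apply: eq_big => [[x y]|[x y] _]; rewrite ?inE //= !cfprodE rmorphM mulrACA.
Qed.

Lemma cfMorph_ext_char (aT rT : finGroupType) (D A : {group aT}) (B : {group rT})
    (f : {morphism D >-> rT}) (phi : 'CF(B)) :
  A \subset D -> f @* A = B -> phi \is a character ->
  exists2 psi : 'CF(A), psi \is a character & {in A, forall x, psi x = phi (f x)}.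
Proof.
move=> sAD fA; have eqB: (f @* A)%G = B by apply: val_inj.
case: B / eqB phi {fA} => phi Nphi.
by exists (cfMorph phi) => [|x Ax]; rewrite ?cfMorph_char // cfMorphE.
Qed.

Lemma cfprod_char phi theta :
  phi \is a character -> theta \is a character -> cfprod phi theta \is a character.
Proof.
move=> Nphi Ntheta.
have [a Na aE] := cfMorph_ext_char (subsetT _) (morphim_fstX M N) Nphi.
have [b Nb bE] := cfMorph_ext_char (subsetT _) (morphim_sndX M N) Ntheta.
suff -> : cfprod phi theta = a * b by rewrite rpredM.
by apply/cfun_inP=> x Gx; rewrite !cfunE aE ?bE.
Qed.

Lemma cfprod_irr i j : cfprod 'chi[M]_i 'chi[N]_j \in irr (setX M N).
Proof.
by rewrite irrEchar cfprod_char ?irr_char //= cfdot_prod !cfnorm_irr mulr1.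
Qed.

Definition prod_Iirr (i : Iirr M) (j : Iirr N) : Iirr (setX M N) :=
  cfIirr (cfprod 'chi_i 'chi_j).

Lemma prod_IirrE i j : 'chi_(prod_Iirr i j) = cfprod 'chi_i 'chi_j.
Proof. by rewrite cfIirrE ?cfprod_irr. Qed.

Definition Iirr_setX (X : {set Iirr M}) (Y : {set Iirr N}) :
    {set Iirr (setX M N)} :=
  [set prod_Iirr i j | i in X, j in Y].

End ExternalProduct.

(* Main.v *)
Require Import Defs.
From HB Require Import structures.
From mathcomp Require Import all_boot all_order all_fingroup all_algebra.
From mathcomp Require Import all_solvable all_field all_character.

(** The products of irreducible characters are distinct, and their squared
    degrees sum to |M| |N| = |M x N|, so they exhaust Irr(M x N). Products of
    blocks therefore partition both Irr(M x N) and M x N, and both families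
    have |XX| |YY| = |KK| |LL| members. The characters chi_X x chi_Y are
    witnesses, since (phi x theta, phi' x theta') = (phi, phi') (theta, theta'). *)

Set Implicit Arguments.
Unset Strict Implicit.
Unset Printing Implicit Defensive.

Import Order.TTheory GroupScope GRing.Theory Num.Theory.
Local Open Scope ring_scope.

Lemma partition_block_eq (T : finType) (P : {set {set T}}) (D A B : {set T}) x :
  partition P D -> A \in P -> B \in P -> x \in A -> x \in B -> A = B.
Proof.
case/and3P=> _ tiP _ PA PB Ax Bx.
by rewrite -(def_pblock tiP PA Ax) (def_pblock tiP PB Bx).
Qed.

Section PartitionImset2.

Variables (aT bT cT : finType) (f : aT -> bT -> cT).
Hypothesis injf : injective (fun p : aT * bT => f p.1 p.2).
Variables (P : {set {set aT}}) (Q : {set {set bT}}).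
Variables (A : {set aT}) (B : {set bT}).
Hypotheses (partP : partition P A) (partQ : partition Q B).

Lemma mem_imset2_inj x y (X : {set aT}) (Y : {set bT}) :
  (f x y \in f @2: (X, Y)) = (x \in X) && (y \in Y).
Proof.
apply/imset2P/andP=> [[x' y' Xx' Yy' /(injf (x1 := (x, y)) (x2 := (x', y')))]|].
  by case=> -> ->.
by case=> Xx Yy; exists x y.
Qed.

(** By injectivity of [f] a common point [z] has only one pair of coordinates, so [X] meets [X'] and
    [Y] meets [Y']; blocks of a partition that meet are equal. *)
Lemma imset2_block_eq X X' Y Y' z :
  X \in P -> X' \in P -> Y \in Q -> Y' \in Q ->
  z \in f @2: (X, Y) -> z \in f @2: (X', Y') -> X = X' /\ Y = Y'.
Proof.
move=> PX PX' QY QY' /imset2P[x y Xx Yy ->]; rewrite mem_imset2_inj.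
case/andP=> X'x Y'y; split.
  exact: partition_block_eq partP PX PX' Xx X'x.
exact: partition_block_eq partQ QY QY' Yy Y'y.
Qed.

(** Kept general in [f] so as to serve twice: with [prod_Iirr] for characters and with [pair] for
    group elements. *)
Lemma partition_imset2 :
  partition [set f @2: (X, Y) | X : {set aT} in P, Y : {set bT} in Q] (f @2: (A, B)).
Proof.
have [/eqP covP _ _] := and3P partP; have [/eqP covQ _ _] := and3P partQ.
apply/and3P; split.
- apply/eqP/setP=> z; apply/bigcupP/imset2P.
    case=> _ /imset2P[X Y PX QY ->] /imset2P[x y Xx Yy ->]; exists x y => //.
      by rewrite -covP; apply/bigcupP; exists X.
    by rewrite -covQ; apply/bigcupP; exists Y.
  case=> x y; rewrite -covP -covQ => /bigcupP[X PX Xx] /bigcupP[Y QY Yy] ->.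
  by exists (f @2: (X, Y)); rewrite ?mem_imset2_inj ?Xx //; apply/imset2P; exists X Y.
- apply/trivIsetP=> _ _ /imset2P[X Y PX QY ->] /imset2P[X' Y' PX' QY' ->].
  apply: contraR => /pred0Pn[z /andP[XYz XYz']].
  by have [-> ->] := imset2_block_eq PX PX' QY QY' XYz XYz'.
- apply/imset2P=> -[X Y PX QY /esym/setP XY0].
  have /set0Pn[x Xx] := partition_neq0 partP PX.
  have /set0Pn[y Yy] := partition_neq0 partQ QY.
  by have := XY0 (f x y); rewrite mem_imset2_inj inE Xx Yy.
Qed.

(** Blocks are non-empty, so a product block contains some [f x y], and that point determines both
    factors. *)
Lemma card_partition_imset2 :
  #|[set f @2: (X, Y) | X : {set aT} in P, Y : {set bT} in Q]| = (#|P| * #|Q|)%N.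
Proof.
rewrite curry_imset2X card_in_imset ?cardsX //.
move=> [X Y] [X' Y']; rewrite !inE /= => /andP[PX QY] /andP[PX' QY'] eqXY.
have /set0Pn[x Xx] := partition_neq0 partP PX.
have /set0Pn[y Yy] := partition_neq0 partQ QY.
have XYz : f x y \in f @2: (X, Y) by rewrite mem_imset2_inj Xx.
have XYz' : f x y \in f @2: (X', Y') by rewrite -eqXY.
by have [-> ->] := imset2_block_eq PX PX' QY QY' XYz XYz'.
Qed.

End PartitionImset2.

Lemma imset2_pair (aT bT : finType) (A : {set aT}) (B : {set bT}) :
  pair @2: (A, B) = setX A B.
Proof. by rewrite curry_imset2X -[RHS]imset_id; apply: eq_imset => -[]. Qed.

Section ProdIirr.

Variables (gT1 gT2 : finGroupType) (M : {group gT1}) (N : {group gT2}).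

(** If the two products coincide, their inner product is 1; it is also the product of the Kronecker
    deltas of [i], [i'] and of [j], [j'], so neither delta vanishes. *)
Lemma prod_Iirr_inj :
  injective (fun p : Iirr M * Iirr N => prod_Iirr p.1 p.2).
Proof.
move=> [i j] [i' j'] /= /(congr1 (fun k => 'chi_k)).
rewrite !prod_IirrE => eq_chi.
have := cfdot_prod 'chi_i 'chi_i' 'chi_j 'chi_j'.
rewrite -eq_chi cfdot_prod !cfnorm_irr mulr1 !cfdot_irr => /eqP.
by case: (i =P i') => [->|_]; case: (j =P j') => [->|_]; rewrite ?mulr0 ?mul0r ?oner_eq0.
Qed.

Lemma prod_Iirr_setT :
  @prod_Iirr _ _ M N @2: ([set: Iirr M], [set: Iirr N]) =
  [set: Iirr (setX M N)].
Proof.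
set J := _ @2: (_, _); apply/eqP; rewrite -subTset; apply/subsetP=> k _.
(* Reindexed by pairs, the sum factors into the sums of squared degrees for [M] and for [N]. *)
have sumJ : \sum_(l in J) 'chi_l 1%g ^+ 2 = #|setX M N|%:R.
  rewrite /J curry_imset2X big_imset /=; last first.
    by move=> [i j] [i' j'] _ _; apply: (@prod_Iirr_inj (i, j) (i', j')).
  rewrite cardsX natrM -!irr_sum_square big_distrlr pair_big.
  apply: eq_big => [p|[i j] _] /=; first by rewrite !inE.
  by rewrite prod_IirrE cfprodE exprMn.
(* The characters in [J] already use up the whole sum of squared degrees, so those outside [J]
   contribute 0 in total; a missing [k] would make that contribution positive. *)
apply: contraT => nJk.
have := irr_sum_square (setX_group M N).
rewrite (bigID (mem J)) /= sumJ => /eqP; rewrite -subr_eq0 addrAC subrr add0r.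
rewrite (bigD1 k) //= gt_eqF // ltr_wpDr //.
  by apply: sumr_ge0 => l _; rewrite exprn_ge0 // ltW ?irr1_gt0.
by rewrite exprn_gt0 ?irr1_gt0.
Qed.

Lemma prod_Iirr_surj k : exists i j, k = @prod_Iirr _ _ M N i j.
Proof.
have: k \in [set: Iirr (setX M N)] by rewrite inE.
by rewrite -prod_Iirr_setT => /imset2P[i j _ _ ->]; exists i, j.
Qed.

(** The multiplicity of a product is the product of the multiplicities, hence non-zero exactly when
    both are. *)
Lemma constt_cfprod (phi : 'CF(M)) (theta : 'CF(N)) i j :
  (prod_Iirr i j \in irr_constt (cfprod phi theta)) =
  (i \in irr_constt phi) && (j \in irr_constt theta).
Proof. by rewrite !irr_consttE prod_IirrE cfdot_prod mulf_eq0 negb_or. Qed.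

End ProdIirr.

Theorem lemma2p1 (gT1 gT2 : finGroupType) (M : {group gT1}) (N : {group gT2})
    (XX : {set {set Iirr M}}) (KK : {set {set gT1}})
    (YY : {set {set Iirr N}}) (LL : {set {set gT2}}) :
  supercharacter_theory M XX KK ->
  supercharacter_theory N YY LL ->
  supercharacter_theory (setX_group M N)
    [set Iirr_setX X Y | X in XX, Y in YY]
    [set setX K L | K in KK, L in LL].
Proof.
case=> partX partK cardXK [chi [chiN chiX chiK chiT]].
case=> partY partL cardYL [psi [psiN psiY psiL psiT]].
have inj_pair : injective (fun p : gT1 * gT2 => (p.1, p.2)).
  by move=> [x y] [x' y'].
have defKL : [set setX K L | K in KK, L in LL] =
             [set pair @2: (K, L) | K : {set gT1} in KK, L : {set gT2} in LL].
  by rewrite !curry_imset2X; apply: eq_imset => -[K L]; rewrite /= imset2_pair.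
split.
- rewrite -prod_Iirr_setT.
  exact (partition_imset2 (@prod_Iirr_inj _ _ M N) partX partY).
- rewrite defKL /= -imset2_pair.
  exact (partition_imset2 inj_pair partK partL).
- rewrite defKL (card_partition_imset2 inj_pair partK partL) -cardXK -cardYL.
  exact (card_partition_imset2 (@prod_Iirr_inj _ _ M N) partX partY).
(* The witness must depend on the set [Z] alone, so its factors are recovered by a choice. The
   default 0 is taken only when [Z] is not a product of blocks. *)
pose blocks Z (p : {set Iirr M} * {set Iirr N}) :=
  [&& p.1 \in XX, p.2 \in YY & Iirr_setX p.1 p.2 == Z].
pose zeta Z := if [pick p | blocks Z p] is Some p
               then cfprod (chi p.1) (psi p.2) else 0.
have zetaP Z : Z \in [set Iirr_setX X Y | X in XX, Y in YY] ->
    exists X Y, [/\ X \in XX, Y \in YY, Z = Iirr_setX X Y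
                  & zeta Z = cfprod (chi X) (psi Y)].
  case/imset2P=> X Y XX_X YY_Y defZ; rewrite /zeta.
  case: pickP => [[X' Y'] /and3P[/= XX_X' YY_Y' /eqP defZ']|/(_ (X, Y))].
    by exists X', Y'.
  by rewrite /blocks /= XX_X YY_Y defZ eqxx.
exists zeta; split.
- move=> _ /zetaP[X [Y [XX_X YY_Y _ ->]]].
  by apply: cfprod_char; [apply: chiN | apply: psiN].
- move=> _ /zetaP[X [Y [XX_X YY_Y -> ->]]] k.
  have [i [j ->]] := prod_Iirr_surj k; rewrite constt_cfprod => /andP[chi_i psi_j].
  by apply/imset2P; exists i j; [apply: chiX chi_i | apply: psiY psi_j |].
- move=> _ _ /zetaP[X [Y [XX_X YY_Y _ ->]]] /imset2P[K L KK_K LL_L ->].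
  move=> [m n] [m' n'] /setXP[Km Ln] /setXP[Km' Ln'].
  by rewrite !cfprodE (chiK X K XX_X KK_K m m') // (psiL Y L YY_Y LL_L n n').
move=> k; have [i [j ->]] := prod_Iirr_surj k.
have [X XX_X chi_i] := chiT i; have [Y YY_Y psi_j] := psiT j.
exists (Iirr_setX X Y); first by apply/imset2P; exists X Y.
have ZZ_XY : Iirr_setX X Y \in [set Iirr_setX X Y | X in XX, Y in YY].
  by apply/imset2P; exists X Y.
(* The factors chosen by [zeta] are not known in advance to be [X] and [Y]; the common element
   [prod_Iirr i j] forces them to be. *)
have [X' [Y' [XX_X' YY_Y' eqXY ->]]] := zetaP _ ZZ_XY.
have XYij : prod_Iirr i j \in Iirr_setX X Y.
  by apply/imset2P; exists i j; [apply: chiX chi_i | apply: psiY psi_j |].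
have X'Y'ij : prod_Iirr i j \in Iirr_setX X' Y' by rewrite -eqXY.
have [<- <-] := imset2_block_eq (@prod_Iirr_inj _ _ M N) partX partY
  XX_X XX_X' YY_Y YY_Y' XYij X'Y'ij.
by rewrite constt_cfprod chi_i.
Qed.
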